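(* Let $\ell\geq 1$ be any integer, let $c$ range over positive integers and $p$ over primes. Then: (a) $\displaystyle \lim_{(c-1)\to\infty}\frac{\sum_{5\leq p\leq c-1,\ p\mid (c-1) \text{ in } \mathbb{Z}_p}Y_c(p)}{\sum_{5\leq p\leq c-1,\ p\mid (c-1)\text{ in }\mathbb{Z}_p}1}=1$; (b) $\displaystyle \lim_{c\to\infty}\frac{\sum_{5\leq p\leq c,\ p\mid c \text{ in } \mathbb{Z}_p}Y_c(p)}{\sum_{5\leq p\leq c,\ p\mid c\text{ in }\mathbb{Z}_p}1}=2$; (c) $\displaystyle \lim_{(c+1)\to\infty}\frac{\sum_{5\leq p\leq c+1,\ p\mid (c+1) \text{ in } \mathbb{Z}_p}Y_c(p)}{\sum_{5\leq p\leq c+1,\ p\mid (c+1)\text{ in }\mathbb{Z}_p}1}=0$.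
   Context: For a prime $p\geq 5$, an integer $\ell\geq 1$ and $c\in\mathbb{Z}_p$ (the $p$-adic integers), $Y_c(p):=\#\{z\in\mathbb{Z}_p/p\mathbb{Z}_p : z^{(p-1)^\ell}+c-z\equiv 0\pmod{p\mathbb{Z}_p}\}$. The coefficient $c$ is restricted to the subring $\mathbb{Z}\subset\mathbb{Z}_p$. All sums run over primes $p$ satisfying the listed conditions. In each limit, $c$ runs over those integers for which the denominator is nonzero. *)

(* Defs.v *)
From HB Require Import structures.
From mathcomp Require Import all_boot all_order all_algebra finmap.
From mathcomp Require Import generic_quotient ring_quotient.
From mathcomp Require Import all_classical all_reals all_analysis.
Import Order.TTheory GRing.Theory Num.Theory.
Import numFieldNormedType.Exports.

Set Implicit Arguments.
Unset Strict Implicit.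
Unset Printing Implicit Defensive.

Local Open Scope classical_set_scope.
Local Open Scope ring_scope.

Definition prime_nat := {p : nat | prime p}.

(* The ring of p-adic integers, as the inverse limit of the rings Z/p^n:      *)
(* the component x n in Z/p^n is given by its representative in [0, p^n).     *)
(* The condition below forces x n to be this representative, and x n.+1 to    *)
(* be congruent to x n modulo p^n.                                            *)
Definition coherent (p : prime_nat) (x : nat -> int) : Prop :=
  forall n, x n = (x n.+1 %% (val p ^ n)%N)%Z.

Record padic_int (p : prime_nat) := PadicInt {
  padic_val :> nat -> int;
  padic_coherent : coherent p padic_val }.

HB.instance Definition _ (p : prime_nat) := gen_eqMixin (padic_int p).
HB.instance Definition _ (p : prime_nat) := gen_choiceMixin (padic_int p).

Section PadicRing.
Variable p : prime_nat.
Local Notation pw n := ((val p ^ n)%N : int).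
Implicit Types x y z : padic_int p.

Lemma padic_eq x y : (forall n, x n = y n) -> x = y.
Proof.
case: x y => [x xP] [y yP] /= exy; have {}exy : x = y by apply/funext.
by case: _ / exy in yP *; rewrite (Prop_irrelevance xP yP).
Qed.

Lemma padic_modz x n : (x n %% pw n)%Z = x n.
Proof. by rewrite padic_coherent modz_mod. Qed.

Lemma modz_pwS (a : int) n : ((a %% pw n.+1)%Z %% pw n)%Z = (a %% pw n)%Z.
Proof.
by rewrite [in RHS](divz_eq a (pw n.+1)) expnS PoszM mulrA modzMDl.
Qed.

Fact coherent_modz (a : int) : coherent p (fun n => (a %% pw n)%Z).
Proof. by move=> n; rewrite modz_pwS. Qed.

Fact coherentD x y : coherent p (fun n => ((x n + y n) %% pw n)%Z).
Proof. by move=> n; rewrite modz_pwS -[in RHS]modzDm -!padic_coherent. Qed.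

Fact coherentN x : coherent p (fun n => ((- x n) %% pw n)%Z).
Proof. by move=> n; rewrite modz_pwS -[in RHS]modzNm -padic_coherent. Qed.

Fact coherentM x y : coherent p (fun n => ((x n * y n) %% pw n)%Z).
Proof. by move=> n; rewrite modz_pwS -[in RHS]modzMm -!padic_coherent. Qed.

Definition padic_of_int (a : int) := PadicInt (coherent_modz a).
Definition padic_add x y := PadicInt (coherentD x y).
Definition padic_opp x := PadicInt (coherentN x).
Definition padic_mul x y := PadicInt (coherentM x y).

Fact padic_addA : associative padic_add.
Proof. by move=> x y z; apply: padic_eq => n /=; rewrite modzDmr modzDml addrA. Qed.

Fact padic_addC : commutative padic_add.
Proof. by move=> x y; apply: padic_eq => n /=; rewrite addrC. Qed.

Fact padic_add0 : left_id (padic_of_int 0) padic_add.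
Proof. by move=> x; apply: padic_eq => n /=; rewrite mod0z add0r padic_modz. Qed.

Fact padic_addN : left_inverse (padic_of_int 0) padic_opp padic_add.
Proof. by move=> x; apply: padic_eq => n /=; rewrite modzDml addNr. Qed.

HB.instance Definition _ := GRing.isZmodule.Build (padic_int p)
  padic_addA padic_addC padic_add0 padic_addN.

Fact padic_mulA : associative padic_mul.
Proof. by move=> x y z; apply: padic_eq => n /=; rewrite modzMmr modzMml mulrA. Qed.

Fact padic_mulC : commutative padic_mul.
Proof. by move=> x y; apply: padic_eq => n /=; rewrite mulrC. Qed.

Fact padic_mul1 : left_id (padic_of_int 1) padic_mul.
Proof. by move=> x; apply: padic_eq => n /=; rewrite modzMml mul1r padic_modz. Qed.

Fact padic_mulDl : left_distributive padic_mul padic_add.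
Proof.
by move=> x y z; apply: padic_eq => n /=; rewrite modzMml modzDm mulrDl.
Qed.

Fact modz_p_small (a : int) : 0 <= a < 2 -> (a %% pw 1)%Z = a.
Proof.
case/andP=> a0 a2; rewrite modz_small // a0 (lt_le_trans a2) //.
by rewrite expn1 lez_nat prime_gt1 // (valP p).
Qed.

Fact padic_1neq0 : padic_of_int 1 != 0.
Proof.
by apply/eqP => /(congr1 (fun x : padic_int p => x 1%N)) /=; rewrite !modz_p_small.
Qed.

HB.instance Definition _ := GRing.Zmodule_isComNzRing.Build (padic_int p)
  padic_mulA padic_mulC padic_mul1 padic_mulDl padic_1neq0.

Lemma padic_intr (a : int) n : (a%:~R : padic_int p) n = (a %% pw n)%Z.
Proof.
have natE (k : nat) : (k%:R : padic_int p) n = (k%:Z %% pw n)%Z.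
  by elim: k => [//|k IHk]; rewrite -natr1 /= IHk modzDm -PoszD addn1.
case: a => k; first exact: natE.
by rewrite NegzE mulrNz /= natE modzNm.
Qed.

Definition padic_dvd (a b : padic_int p) : Prop := exists q, b = q * a.

Definition padic_pideal : {pred padic_int p} :=
  fun x => `[< padic_dvd (val p)%:R x >].

Fact padic_pideal_closed : idealr_closed padic_pideal.
Proof.
split.
- by apply/asboolP; exists 0; rewrite mul0r.
- apply/asboolP => -[q /(congr1 (fun x : padic_int p => x 1%N)) /=].
  rewrite (padic_intr (val p)) modzMmr.
  by rewrite [LHS]modz_p_small // expn1 modzMl.
- move=> a _ _ /asboolP[u ->] /asboolP[v ->]; apply/asboolP.
  by exists (a * u + v); rewrite mulrDl mulrA.
Qed.

HB.instance Definition _ :=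
  isIdealr.Build (padic_int p) padic_pideal padic_pideal_closed.

Definition padic_residue := {ideal_quot padic_pideal}.
HB.instance Definition _ := GRing.ComNzRing.on padic_residue.

Definition residue (c : padic_int p) : padic_residue := (\pi c)%qT.

End PadicRing.

(* Y_c(p). The set counted is finite, so that fset_set is not the junk value  *)
(* fset0.                                                                     *)
Definition Y (l : nat) (p : prime_nat) (c : padic_int p) : nat :=
  #|` fset_set [set z : padic_residue p |
                 z ^+ ((val p).-1 ^ l) + residue c - z = 0] |.

Definition primes_dvd (a : int) : set prime_nat :=
  [set p | [/\ (5 <= val p)%N, (val p)%:Z <= a &
               padic_dvd (val p)%:R (a%:~R : padic_int p)]].

Section Averages.
Variable R : realType.

Definition sumY (l : nat) (a c : int) : R :=
  \sum_(p \in primes_dvd a) ((Y l (c%:~R : padic_int p))%:R : R).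

Definition sum1 (a : int) : R := \sum_(p \in primes_dvd a) (1 : R).

(* The filter "a c tends to +oo", where c runs over the positive integers     *)
(* such that the denominator sum1 (a c) is nonzero.                           *)
Definition to_infty (a : int -> int) : set_system int :=
  within [set c | 0 < c /\ sum1 (a c) != 0]
    (filter_from [set: int] (fun M => [set c | M <= a c])).

End Averages.

(* Main.v *)
Require Import Defs.
From mathcomp Require Import all_boot all_order all_algebra.
From mathcomp Require Import finmap generic_quotient ring_quotient cyclic.
From mathcomp Require Import all_classical all_reals all_analysis.
Import Order.TTheory GRing.Theory Num.Theory.
Import numFieldNormedType.Exports.
Local Open Scope classical_set_scope.
Local Open Scope ring_scope.

(** For a fixed integer [e], let [p >= 5] be a prime dividing [c - e].  Then
    [Y l p c] counts the [z] in Z_p/pZ_p with [z ^ ((p-1)^l) + e = z].  The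
    residue ring is the field with [p] elements, so by Fermat's little theorem
    [z ^ ((p-1)^l)] is [0] for [z = 0] and [1] otherwise, and the equation
    becomes [e = 0] (when [z = 0]) or [z = 1 + e] (when [z <> 0]).  Since
    [1] and [2] are nonzero modulo [p], there is one solution for [e = 1]
    ([z = 2]), two for [e = 0] ([z = 0, 1]), and none for [e = -1].  Every
    term of the sum in the numerator is therefore the same number, and the
    quotient is constant wherever its denominator is nonzero.

    The only arithmetic of Z_p involved is that a p-adic integer is
    congruent modulo [p] to an ordinary natural number ([residue_natP]), which
    transports Fermat's theorem from the natural numbers
    ([residue_fermat]). *)

Section Residue.
Variable p : prime_nat.
Local Notation pw n := ((val p ^ n)%N : int).
Implicit Types (x : padic_int p) (z : padic_residue p).

Let p_gt1 : (1 < val p)%N. Proof. exact: prime_gt1 (valP p). Qed.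

Lemma padic_digit0E x n : (x n.+1 %% val p)%Z = x 1%N.
Proof.
elim: n => [|n IHn]; first by rewrite -[val p]expn1 padic_modz.
rewrite -IHn (padic_coherent x n.+1) [x n.+2 in LHS](divz_eq _ (pw n.+1)).
by rewrite expnSr PoszM mulrA modzMDl.
Qed.

(** The quotient of the p-adic integer [x], minus its last digit, by [p]: the
    digits shift by one place, hence the index [n.+1]. *)
Fact coherent_shift x : coherent p (fun n => (x n.+1 %/ val p)%Z).
Proof.
move=> n; rewrite (padic_coherent x n.+1).
set a := x n.+2; have p0 : (val p)%:Z != 0 by rewrite -lt0n ltnW.
rewrite [a in RHS](divz_eq a (pw n.+1)) expnSr PoszM mulrA divzMDl // modzMDl.
have p_gt0 : 0 < (val p)%:Z by rewrite ltz_nat ltnW.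
have pw_gt0 : 0 < pw n * (val p)%:Z by rewrite mulr_gt0 // ltz_nat expn_gt0 ltnW.
rewrite [RHS]modz_small //; apply/andP; split.
  by rewrite divz_ge0 // modz_ge0 // gt_eqF.
by rewrite ltz_divLR // ltz_pmod.
Qed.

Definition padic_shift x := PadicInt (coherent_shift x).

Lemma padic_shiftK x : x = padic_shift x * (val p)%:R + (x 1%N)%:~R.
Proof.
apply: padic_eq => n /=.
rewrite (padic_intr p (x 1%N)) (padic_intr p (val p)) modzMmr modzDm.
by rewrite -(padic_digit0E x n) -divz_eq -padic_coherent.
Qed.

Lemma residue_int (a : int) : residue (a%:~R : padic_int p) = a%:~R.
Proof. exact: (rmorph_int (@residue p)). Qed.

Lemma residue_dvd x : padic_dvd (val p)%:R x -> residue x = 0.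
Proof.
move=> px; rewrite -(rmorph0 (@residue p)).
by apply/eqP; rewrite /residue -Quotient.idealrBE subr0; apply/asboolP.
Qed.

Lemma residue_char : (val p)%:R = 0 :> padic_residue p.
Proof.
by rewrite -(rmorph_nat (@residue p)); apply: residue_dvd; exists 1; rewrite mul1r.
Qed.

Lemma residue_modn (k : nat) : k%:R = (k %% val p)%:R :> padic_residue p.
Proof. by rewrite {1}(divn_eq k (val p)) natrD natrM residue_char mulr0 add0r. Qed.

(** The last digit of a representative is the required number: the quotient
    map kills the rest, a multiple of [p]. *)
Lemma residue_natP z : exists k : nat, z = k%:R.
Proof.
pose x := repr z; exists `|x 1%N|%N.
have x1_ge0 : 0 <= x 1%N.
  by rewrite -(padic_modz x) modz_ge0 // -lt0n expn1 ltnW.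
rewrite pmulrn gez0_abs // -residue_int -[LHS]reprK -/x.
rewrite {1}(padic_shiftK x) (rmorphD (@residue p)).
by rewrite [X in X + _]residue_dvd ?add0r //; exists (padic_shift x).
Qed.

Lemma residue_fermat z : z != 0 -> z ^+ (val p).-1 = 1.
Proof.
have [k ->] := residue_natP z => k0.
have pk : coprime k (val p).
  rewrite coprime_sym prime_coprime ?(valP p) //; apply: contraNN k0 => /eqP pk.
  by rewrite residue_modn pk.
rewrite -natrX residue_modn -totient_prime ?(valP p) //.
by rewrite Euler_exp_totient // modn_small.
Qed.

Lemma residue_expr z (l : nat) :
  (0 < l)%N -> z ^+ ((val p).-1 ^ l) = (z != 0)%:R.
Proof.
case: l => // l _; have [->|z0] := eqVneq z 0.
  by rewrite expr0n expn_eq0 -leqn0 leqNgt -ltnS prednK ?p_gt1 // ltnW.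
by rewrite expnS exprM residue_fermat // expr1n.
Qed.

(** As [p = 2 m + 1] vanishes in the residue ring, [2 = 0] would force [1 = 0]. *)
Lemma residue_two_neq0 : (5 <= val p)%N -> 2 != 0 :> padic_residue p.
Proof.
move=> p5; have odd_p : odd (val p).
  by case: (even_prime (valP p)) p5 => [->|].
apply/eqP => two0; have := oner_neq0 (padic_residue p).
have := residue_char; rewrite -(odd_double_half (val p)) odd_p -muln2.
by rewrite natrD natrM two0 mulr0 addr0 => /eqP one0 /negP; apply.
Qed.

End Residue.

Section Count.
Variables (p : prime_nat) (l : nat) (c : padic_int p).
Hypothesis l_gt0 : (0 < l)%N.
Implicit Type z : padic_residue p.

(** By Fermat, the equation only depends on whether [z] is zero, so its
    solutions can be read off. *)
Let solE z :
  (z ^+ ((val p).-1 ^ l) + residue c - z = 0) <-> z = (z != 0)%:R + residue c.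
Proof.
rewrite residue_expr //; split=> /eqP; first by rewrite subr_eq0 => /eqP.
by rewrite eq_sym -subr_eq0 => /eqP.
Qed.

Lemma Y_res1 : (5 <= val p)%N -> residue c = 1 -> Y l c = 1%N.
Proof.
move=> p5 c1; rewrite /Y (_ : mkset _ = [set 2]) ?fset_set1 ?cardfs1 //.
apply/seteqP; split=> z /=; rewrite solE c1.
  by have [->/esym/eqP|_ ->] := eqVneq z 0; rewrite ?add0r ?oner_eq0.
by move->; rewrite residue_two_neq0.
Qed.

Lemma Y_res0 : residue c = 0 -> Y l c = 2%N.
Proof.
move=> c0; rewrite /Y (_ : mkset _ = [set 0; 1]).
  by rewrite fset_setU // !fset_set1 cardfs2 eq_sym oner_eq0.
apply/seteqP; split=> z /=; rewrite solE c0 addr0.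
  by have [->|_ ->] := eqVneq z 0; [left | right].
by case=> ->; rewrite ?eqxx ?oner_eq0.
Qed.

Lemma Y_resN1 : residue c = -1 -> Y l c = 0%N.
Proof.
move=> cN1; rewrite /Y (_ : mkset _ = set0) ?fset_set0 //.
apply/seteqP; split=> z //=; rewrite solE cN1.
have [->/esym/eqP|z0 /eqP] := eqVneq z 0; first by rewrite add0r oppr_eq0 oner_eq0.
by rewrite subrr (negPf z0).
Qed.

End Count.

Lemma residue_sub_dvd (p : prime_nat) (c e : int) :
  padic_dvd (val p)%:R ((c - e)%:~R : padic_int p) ->
  residue (c%:~R : padic_int p) = e%:~R.
Proof.
by move=> /(@residue_dvd p); rewrite !residue_int intrB => /eqP; rewrite subr_eq0 => /eqP.
Qed.

(** Along the filter the ratio equals [k] exactly, so no estimate enters. *)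
Lemma cvg_average (R : realType) (l k : nat) (a : int -> int) :
  (forall c p, primes_dvd (a c) p -> Y l (c%:~R : padic_int p) = k) ->
  sumY R l (a c) c / sum1 R (a c) @[c --> to_infty R a] --> (k%:R : R).
Proof.
move=> Yk A /nbhs_singleton Ak; exists 0 => // c _ [_ den0] /=.
rewrite (_ : sumY _ _ _ _ = k%:R * sum1 R (a c)) ?mulfK //.
rewrite /sum1 mulr_fsumr; apply: eq_fsbigr => p; rewrite inE => pa.
by rewrite (Yk c p pa) mulr1.
Qed.

Theorem corollary7p5 (R : realType) (l : nat) (hl : (1 <= l)%N) :
  [/\ sumY R l (c - 1) c / sum1 R (c - 1)
        @[c --> to_infty R (fun c => c - 1)] --> (1 : R),
      sumY R l c c / sum1 R c
        @[c --> to_infty R (fun c => c)] --> (2 : R) &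
      sumY R l (c + 1) c / sum1 R (c + 1)
        @[c --> to_infty R (fun c => c + 1)] --> (0 : R)].
Proof.
split.
- apply: (@cvg_average R l 1) => c p [p5 _ pc].
  by apply: Y_res1 => //; apply: (@residue_sub_dvd p c 1).
- apply: (@cvg_average R l 2) => c p [_ _ pc].
  by apply: Y_res0 => //; apply: (@residue_sub_dvd p c 0); rewrite subr0.
- apply: (@cvg_average R l 0) => c p [_ _ pc].
  by apply: Y_resN1 => //; apply: (@residue_sub_dvd p c (-1)); rewrite opprK.
Qed.
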